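(* Let $k=\mathbb F_q$ with $q\equiv5\pmod6$, let $d\ge1$ be an integer with $\gcd(2d+1,q-1)=1$, and let $n\ge2$. Let $Y^{2n-2}=\{\overline A=\overline B=0\}\subset\mathbb P^{2n}$, where $$\overline A=u_0^{2d+1}+\sum_{i=0}^{n-1}(u_{2i+1}+3u_{2i+2})(u_{2i+1}^2+3u_{2i+2}^2)^d,\qquad\overline B=u_0^{2d+1}+\sum_{i=0}^{n-1}(u_{2i+1}-u_{2i+2})(u_{2i+1}^2+3u_{2i+2}^2)^d.$$ Then $$|Y^{2n-2}(k)|=|\mathbb P^{2n-2}(k)|=\frac{q^{2n-1}-1}{q-1}.$$
   Context: Here $u_0,\dots,u_{2n}$ are the homogeneous coordinates on $\mathbb P^{2n}$. *)

(* Defs.v *)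
From HB Require Import structures.
From mathcomp Require Import all_boot all_order all_algebra.
From mathcomp Require Import mpoly.

Set Implicit Arguments.
Unset Strict Implicit.
Unset Printing Implicit Defensive.

Import GRing.Theory.

Local Open Scope ring_scope.

Definition proportional (F : finFieldType) (m : nat) : rel 'rV[F]_m :=
  fun v w => [exists c : F, (c != 0) && (w == c *: v)].

(* P^m(F): a point is the set of all its homogeneous coordinate vectors. *)
Definition proj_space (F : finFieldType) (m : nat) : {set {set 'rV[F]_m.+1}} :=
  equivalence_partition (@proportional F m.+1) [set v | v != 0].

(* For homogeneous polynomials, the case of interest, vanishing at one
   coordinate vector of a point is the same as vanishing at all of them. *)
Definition proj_zeros (F : finFieldType) (m : nat)
    (s : seq {mpoly F[m.+1]}) : {set {set 'rV[F]_m.+1}} :=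
  [set P in proj_space F m |
    [forall v in P, all (fun p => p.@[fun i => v 0 i] == 0) s]].

(* The homogeneous coordinate u_j on P^m; inord makes it meaningful only for
   j <= m. *)
Definition hcoord (R : nzRingType) (m j : nat) : {mpoly R[m.+1]} := 'X_(inord j).

Definition formA (R : nzRingType) (d n : nat) : {mpoly R[(2 * n).+1]} :=
  let u := hcoord R (2 * n) in
  u 0%N ^+ (2 * d + 1) +
  \sum_(i < n) (u (2 * i + 1)%N + 3 * u (2 * i + 2)%N) *
    (u (2 * i + 1)%N ^+ 2 + 3 * u (2 * i + 2)%N ^+ 2) ^+ d.

Definition formB (R : nzRingType) (d n : nat) : {mpoly R[(2 * n).+1]} :=
  let u := hcoord R (2 * n) in
  u 0%N ^+ (2 * d + 1) +
  \sum_(i < n) (u (2 * i + 1)%N - u (2 * i + 2)%N) *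
    (u (2 * i + 1)%N ^+ 2 + 3 * u (2 * i + 2)%N ^+ 2) ^+ d.

(* The F-rational points of Y^{2n-2} in P^{2n}. *)
Definition Ypoints (F : finFieldType) (d n : nat) :
    {set {set 'rV[F]_(2 * n).+1}} :=
  proj_zeros [:: formA F d n; formB F d n].

(* Main.v *)
Require Import Defs.
From HB Require Import structures.
From mathcomp Require Import all_boot all_order all_algebra.
From mathcomp Require Import mpoly.
From mathcomp Require Import fingroup cyclic finfield mxabelem ring zify.

(** Each summand of the defining polynomials is a linear form in z = (x, y) times
    N(z)^d, where N(z) = x^2 + 3 y^2 is the norm of x + y sqrt(-3). The map
    z |-> z N(z)^d turns the summand into a linear form, and it is injective:
    - N is anisotropic, since #|F| = 5 modulo 6 leaves no primitive cube root of
      unity in F, hence no square root of -3 (eisenstein_norm_anisotropic);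
    - N(z N(z)^d) = N(z)^(2 d + 1), and t |-> t^(2 d + 1) is injective on F as
      2 d + 1 is prime to #|F| - 1 (expf_inj). So the image of z determines
      N(z), and with it z.
    Applied to all pairs of coordinates, and together with
    u_0 |-> u_0^(2 d + 1), it gives a bijection of F^(2 n + 1) that carries the
    affine cone over Y to the zeros of two linear forms, independent because
    4 != 0 (twist_inj, mxrank_twisted_forms). This cone therefore has
    q^(2 n - 1) vectors, as many as the cone over P^(2 n - 2), and each point is
    a set of q - 1 nonzero vectors (card_cone). *)

Set Implicit Arguments.
Unset Strict Implicit.
Unset Printing Implicit Defensive.

Import GRing.Theory.

Local Open Scope ring_scope.

(** * Power maps and the norm form x^2 + 3 y^2 *)

(** The additive order of 1 divides both #|F| and every k with k = 0 in F.
    This is how the residue of #|F| modulo 6 becomes 2 != 0 and 3 != 0. *)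
Lemma natr_coprime_card_neq0 (F : finFieldType) (k : nat) :
  coprime k #|F| -> k%:R != 0 :> F.
Proof.
move=> co_k; apply/negP => /eqP k0.
have dvd_k : (#[1%R : F]%g %| k)%N by rewrite order_dvdn FinRing.zmodXgE k0.
have dvd_F : (#[1%R : F]%g %| #|F|)%N.
  by rewrite -cardsT; apply: order_dvdG; rewrite inE.
have : (#[1%R : F]%g %| gcdn k #|F|)%N by rewrite dvdn_gcd dvd_k.
rewrite (eqP co_k) dvdn1 order_eq1 => /eqP.
by apply/eqP; rewrite oner_eq0.
Qed.

(** A Bezout inverse of k modulo #|F| - 1 undoes the k-th power, because
    z ^+ (1 + j (#|F| - 1)) = z for all z, including z = 0. *)
Lemma expf_inj (F : finFieldType) (k : nat) :
  (0 < k)%N -> coprime k #|F|.-1 -> injective (fun x : F => x ^+ k).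
Proof.
move=> k_gt0 co_k x y /= exy.
have qE : #|F|.-1.+1 = #|F| by rewrite prednK // (ltnW (finNzRing_gt1 F)).
have expK (z : F) j : z ^+ (j * #|F|.-1).+1 = z.
  elim: j => [|j IHj]; first by rewrite mul0n expr1.
  by rewrite mulSn -addnS exprD IHj -exprSr qE expf_card.
case: (egcdnP #|F|.-1 k_gt0) => a b Eab _.
rewrite (eqP co_k) addn1 in Eab.
by rewrite -(expK x b) -(expK y b) -Eab mulnC !exprM exy.
Qed.

(** The norm of x + y sqrt(-3), in the quadratic extension of F when -3 is not
    a square. *)
Definition eisenstein_norm (F : fieldType) (x y : F) := x ^+ 2 + 3 * y ^+ 2.

(** A zero with y != 0 makes x / y a square root of -3, so (x / y - 1) / 2 is a
    primitive cube root of unity. But #|F| = 2 modulo 3, so cubing is injective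
    on F and 1 is its own only cube root. *)
Lemma eisenstein_norm_anisotropic (F : finFieldType) (x y : F) :
  (#|F| = 5 %[mod 6])%N -> eisenstein_norm x y = 0 -> x = 0 /\ y = 0.
Proof.
move=> hq6; rewrite /eisenstein_norm => N0.
have two0 : 2%:R != 0 :> F.
  by apply: natr_coprime_card_neq0; rewrite coprime2n; lia.
have four0 : 4%:R != 0 :> F by rewrite (natrM _ 2 2) mulf_neq0.
have three0 : 3%:R != 0 :> F.
  by apply: natr_coprime_card_neq0; rewrite prime_coprime //; lia.
have [y0|y_neq0] := eqVneq y 0.
  split=> //; apply/eqP; have /eqP : x ^+ 2 = 0 by rewrite -N0 y0; ring.
  by rewrite expf_eq0.
case/negP: three0.
pose w := (x / y - 1) / 2%:R.
(* w^3 - 1 = (w - 1) (w^2 + w + 1), and 4 (w^2 + w + 1) = (x / y)^2 + 3 *)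
have w3 : w ^+ 3 = 1 ^+ 3.
  have : w ^+ 3 - 1 ^+ 3 =
      (w - 1) * ((x ^+ 2 + 3 * y ^+ 2) / (2 ^+ 2 * y ^+ 2)).
    by rewrite /w; field; rewrite y_neq0 four0 two0.
  by rewrite N0 mul0r mulr0 => /eqP; rewrite subr_eq0 => /eqP.
have w1 : w = 1.
  by apply: expf_inj w3 => //; rewrite prime_coprime //; lia.
have xE : x = 3 * y.
  have -> : x = (2 * w + 1) * y by rewrite /w; field; rewrite y_neq0 two0.
  by rewrite w1; ring.
have : (2 * y) ^+ 2 * 3%:R = 0 :> F by rewrite -[RHS]N0 xE; ring.
by move/eqP; rewrite mulf_eq0 expf_eq0 mulf_eq0 (negbTE two0) (negbTE y_neq0).
Qed.

(** * Straightening the two equations *)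

Section Linearization.
Variables (F : finFieldType) (d n : nat).
Local Notation V := 'rV[F]_(2 * n).+1.
Implicit Types (v w : V) (i : 'I_n) (j : 'I_(2 * n).+1).

(** The coordinates fall into blocks: {0}, and {2 i + 1, 2 i + 2} for i < n.
    Squaring the coordinate in the block {0} makes every block norm quadratic,
    so that u_0 ^ (2 d + 1) and the terms of the sums are treated alike. *)
Definition block_norm v (k : nat) : F :=
  if k is k'.+1 then
    eisenstein_norm (v 0 (inord (2 * k'./2 + 1))) (v 0 (inord (2 * k'./2 + 2)))
  else v 0 (inord 0) ^+ 2.

(** In every block this is z |-> z N(z)^d, with N the block norm. *)
Definition twist v : V := \row_j (v 0 j * block_norm v j ^+ d).

Lemma block_norm_odd v (i : nat) : block_norm v (2 * i + 1) =
  eisenstein_norm (v 0 (inord (2 * i + 1))) (v 0 (inord (2 * i + 2))).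
Proof. by rewrite {1}addn1 /block_norm (mul2n i) doubleK -(mul2n i). Qed.

Lemma block_norm_even v (i : nat) : block_norm v (2 * i + 2) =
  eisenstein_norm (v 0 (inord (2 * i + 1))) (v 0 (inord (2 * i + 2))).
Proof.
by rewrite {1}addn2 /block_norm (mul2n i) /= uphalf_double -(mul2n i).
Qed.

(** The two members of a block are handed out together, with their position in
    the form in which block_norm computes. *)
Lemma coord_ind (P : nat -> Prop) :
  P 0%N -> (forall i, P (2 * i + 1)%N /\ P (2 * i + 2)%N) -> forall j, P j.
Proof.
move=> P0 PS [[|k] lt_k] //=.
have lt_k2 : (k./2 < n)%N by lia.
(* coordinate k + 1 lies in the block of index k / 2, with k either 2 i or
   2 i + 1 *)
have [/= Podd Peven] := PS (Ordinal lt_k2).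
have [k_odd|k_even] := boolP (odd k).
- by have -> : k.+1 = (2 * k./2 + 2)%N by lia.
- by have -> : k.+1 = (2 * k./2 + 1)%N by lia.
Qed.

Lemma twist_coord v (k : nat) : (k <= 2 * n)%N ->
  twist v 0 (inord k) = v 0 (inord k) * block_norm v k ^+ d.
Proof. by move=> le_k; rewrite mxE inordK. Qed.

(** N(z N(z)^d) = N(z) N(z)^(2 d): the twist scales each block by a scalar, and
    the norm is quadratic. *)
Lemma block_norm_twist v j :
  block_norm (twist v) j = block_norm v j ^+ (2 * d + 1).
Proof.
have sqr_d (x y : F) : x ^+ 2 * y ^+ (2 * d) = (x * y ^+ d) ^+ 2.
  by rewrite exprMn -exprM mulnC.
have eisd (x y N : F) : eisenstein_norm (x * N ^+ d) (y * N ^+ d) =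
    eisenstein_norm x y * N ^+ (2 * d).
  by rewrite /eisenstein_norm mulnC exprM; ring.
pose P k := block_norm (twist v) k = block_norm v k ^+ (2 * d + 1).
apply: (@coord_ind P) j => [|i]; rewrite {}/P.
  by rewrite /= twist_coord //= -sqr_d -!exprM -exprD; congr (_ ^+ _); lia.
have le1 : (2 * i + 1 <= 2 * n)%N by have := ltn_ord i; lia.
have le2 : (2 * i + 2 <= 2 * n)%N by have := ltn_ord i; lia.
rewrite !block_norm_odd !block_norm_even !twist_coord //.
by rewrite block_norm_odd block_norm_even eisd -exprS (addn1 (2 * d)).
Qed.

Lemma block_normZ c v j : block_norm (c *: v) j = c ^+ 2 * block_norm v j.
Proof.
pose P k := block_norm (c *: v) k = c ^+ 2 * block_norm v k.
apply: (@coord_ind P) j => [|i]; rewrite {}/P; first by rewrite /= mxE exprMn.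
rewrite !block_norm_odd !block_norm_even /eisenstein_norm !mxE.
by split; ring.
Qed.

Lemma twistZ c v : twist (c *: v) = c ^+ (2 * d + 1) *: twist v.
Proof.
apply/rowP => j; rewrite !mxE block_normZ exprMn -exprM addn1 exprS.
by ring.
Qed.

Lemma twist0 : twist 0 = 0.
Proof. by apply/rowP => j; rewrite !mxE mul0r. Qed.

(** The columns are the linear forms in w_0, w_1, ... that give the two defining
    polynomials after the substitution w = twist v. *)
Definition twisted_forms : 'M[F]_((2 * n).+1, 2) :=
  \matrix_(j, k) (if (j == 0) || odd j then 1 else if k == 0 then 3 else -1).

Lemma sum_coord_pairs (f : nat -> F) m :
  \sum_(0 <= k < (2 * m).+1) f k =
    f 0%N + \sum_(i < m) (f (2 * i + 1)%N + f (2 * i + 2)%N).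
Proof.
elim: m => [|m IHm]; first by rewrite muln0 big_nat1 big_ord0 addr0.
rewrite mulnS 2?big_nat_recr //= IHm big_ord_recr /= -!addrA.
by rewrite addn1 addn2.
Qed.

Lemma mul_twisted_forms v k :
  (v *m twisted_forms) 0 k = v 0 (inord 0) +
    \sum_(i < n) (v 0 (inord (2 * i + 1)) +
                  (if k == 0 then 3 else -1) * v 0 (inord (2 * i + 2))).
Proof.
pose f l := v 0 (inord l) * twisted_forms (inord l) k.
have -> : (v *m twisted_forms) 0 k = \sum_(0 <= l < (2 * n).+1) f l.
  by rewrite mxE big_mkord; apply: eq_bigr => j _; rewrite /f inord_val.
rewrite sum_coord_pairs /f; congr (_ + _).
  by rewrite mxE -val_eqE /= inordK // mulr1.
apply: eq_bigr => i _; have lt_i := ltn_ord i.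
rewrite !mxE -!val_eqE /= !inordK; try lia.
have -> : odd (2 * i + 1) by lia.
have -> : odd (2 * i + 2) = false by lia.
by rewrite orbT !orbF addn2 mulr1 [_ * v _ _]mulrC.
Qed.

Lemma meval_hcoord (v : V) k :
  (hcoord F (2 * n) k).@[fun j => v 0 j] = v 0 (inord k).
Proof. exact: mevalXU. Qed.

Lemma meval_formA v :
  (formA F d n).@[fun j => v 0 j] = (twist v *m twisted_forms) 0 0.
Proof.
rewrite mul_twisted_forms twist_coord //= /formA mevalD rmorphXn /=.
rewrite meval_hcoord -exprM addn1 exprS; congr (_ + _).
rewrite raddf_sum; apply: eq_bigr => i _; have lt_i := ltn_ord i.
rewrite !twist_coord ?block_norm_odd ?block_norm_even; try lia.
rewrite /= !(rmorph_nat, rmorphXn, rmorphM, rmorphD) /= !meval_hcoord.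
by rewrite /eisenstein_norm; ring.
Qed.

Lemma meval_formB v :
  (Defs.formB F d n).@[fun j => v 0 j] = (twist v *m twisted_forms) 0 1.
Proof.
rewrite mul_twisted_forms twist_coord //= /Defs.formB mevalD rmorphXn /=.
rewrite meval_hcoord -exprM addn1 exprS; congr (_ + _).
rewrite raddf_sum; apply: eq_bigr => i _; have lt_i := ltn_ord i.
rewrite !twist_coord ?block_norm_odd ?block_norm_even; try lia.
rewrite /= !(rmorph_nat, rmorphXn, rmorphM, rmorphB, rmorphD) /= !meval_hcoord.
by rewrite /eisenstein_norm; ring.
Qed.

Lemma forms_vanishE v :
  all (fun p => p.@[fun j => v 0 j] == 0) [:: formA F d n; Defs.formB F d n] =
    (twist v *m twisted_forms == 0).
Proof.
rewrite /= meval_formA meval_formB andbT.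
apply/andP/eqP => [[/eqP e0 /eqP e1]|->].
  apply/rowP => k; rewrite [RHS]mxE; case: k => [[|[|k]] lt_k] //.
    by rewrite -[RHS]e0; congr (_ _ _); apply: val_inj.
  by rewrite -[RHS]e1; congr (_ _ _); apply: val_inj.
by rewrite !mxE.
Qed.

Hypothesis hq6 : (#|F| = 5 %[mod 6])%N.

Lemma block_norm_eq0 v j : block_norm v j = 0 -> v 0 j = 0.
Proof.
rewrite -{2}(inord_val j).
apply: (@coord_ind (fun k => block_norm v k = 0 -> v 0 (inord k) = 0)) => [|i].
  by move/eqP; rewrite /= expf_eq0 => /eqP.
rewrite block_norm_odd block_norm_even.
by split=> /(eisenstein_norm_anisotropic hq6) [].
Qed.

(** Rows 0 and 2 are (1, 1) and (3, -1), of determinant -4. *)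
Lemma mxrank_twisted_forms : (0 < n)%N -> \rank twisted_forms = 2%N.
Proof.
move=> n_gt0; rewrite -mxrank_tr; apply/eqP; apply: inj_row_free => c c0.
have four0 : 4%:R != 0 :> F.
  by apply: natr_coprime_card_neq0; rewrite (@coprimeXl 2 2) // coprime2n; lia.
have E0 := congr1 (fun M : 'rV_(2 * n).+1 => M 0 (inord 0)) c0.
have E2 := congr1 (fun M : 'rV_(2 * n).+1 => M 0 (inord 2)) c0.
rewrite !mxE !big_ord_recl big_ord0 !mxE -!val_eqE /= inordK // in E0.
rewrite !mxE !big_ord_recl big_ord0 !mxE -!val_eqE /= inordK in E2; last lia.
have E (x y : F) : x * 1 + (y * 1 + 0) = 0 -> x * 3 + (y * -1 + 0) = 0 ->
    x = 0 /\ y = 0.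
  move=> e0 e2; have x0 : x = 0.
    apply: (mulfI four0); rewrite mulr0.
    have -> : 4 * x = (x * 1 + (y * 1 + 0)) + (x * 3 + (y * -1 + 0)) by ring.
    by rewrite e0 e2 addr0.
  by split=> //; rewrite -e0 x0; ring.
have [c00 c01] := E _ _ E0 E2.
apply/rowP => k; rewrite mxE; case: k => [[|[|k]] lt_k] //.
  by rewrite -[RHS]c00; congr (c _ _); apply: val_inj.
by rewrite -[RHS]c01; congr (c _ _); apply: val_inj.
Qed.

Hypothesis hgcd : coprime (2 * d + 1) #|F|.-1.

(** The block norms of v are recovered from those of its twist, since t |->
    t^(2 d + 1) is injective. A block of nonzero norm is then recovered by
    division, and a block of norm zero is zero by anisotropy. *)
Lemma twist_inj : injective twist.
Proof.
move=> v w eq_vw; apply/rowP => j.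
have eqN : block_norm v j = block_norm w j.
  apply: (expf_inj _ hgcd); first by rewrite addn1.
  by rewrite /= -!block_norm_twist eq_vw.
have [N0|N_neq0] := eqVneq (block_norm v j) 0.
  by rewrite !block_norm_eq0 // -eqN.
apply: (mulIf (expf_neq0 d N_neq0)).
by have /rowP/(_ j) := eq_vw; rewrite !mxE -eqN.
Qed.

(** The twist, an injective map of a finite set to itself, is a bijection. It
    puts the cone over Y in bijection with a linear subspace of codimension 2. *)
Lemma card_twisted_zeros : (0 < n)%N ->
  #|[set v | twist v *m twisted_forms == 0]| = (#|F| ^ (2 * n - 1))%N.
Proof.
move=> n_gt0.
have -> : [set v | twist v *m twisted_forms == 0] =
    twist @^-1: rowg (kermx twisted_forms).
  apply/setP => v; rewrite !inE.
  by apply/eqP/sub_kermxP.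
rewrite on_card_preimset; last exact: onW_bij (injF_bij twist_inj).
by rewrite card_rowg mxrank_ker mxrank_twisted_forms // subSS.
Qed.

End Linearization.

(** * Points of projective space and their cones *)

Section Cones.
Variables (F : finFieldType) (m : nat).
Local Notation V := 'rV[F]_m.+1.

Lemma proportional_equiv : equivalence_rel (@proportional F m.+1).
Proof.
move=> u v w; split=> [|/existsP[c /andP[c0 /eqP ->]]].
  by apply/existsP; exists 1; rewrite oner_eq0 scale1r eqxx.
apply/existsP/existsP => -[b /andP[b0 /eqP ->]].
  by exists (b / c); rewrite mulf_neq0 ?invr_eq0 // scalerA divfK ?eqxx.
by exists (b * c); rewrite mulf_neq0 // scalerA eqxx.
Qed.

Lemma card_line (v : V) : v != 0 -> #|[set w | proportional v w]| = #|F|.-1.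
Proof.
move=> v0; rewrite -(cardsC1 (0 : F)) -(card_imset _ (f := fun c => c *: v)).
  apply: eq_card => w; rewrite inE; apply/existsP/imsetP.
    by case=> c /andP[c0 /eqP ->]; exists c; rewrite ?inE.
  by case=> c; rewrite !inE => c0 ->; exists c; rewrite c0 eqxx.
move=> a b /eqP; rewrite -subr_eq0 -scalerBl scaler_eq0 (negbTE v0) orbF.
by rewrite subr_eq0 => /eqP.
Qed.

(** The points on which Z holds partition the nonzero vectors of the cone Z into
    punctured lines, each with #|F| - 1 elements. *)
Lemma card_cone (Z : pred V) : (forall c v, c != 0 -> Z v -> Z (c *: v)) ->
  Z 0 ->
  (#|[set P in proj_space F m | [forall v in P, Z v]]| * #|F|.-1)%N =
    #|[set v | Z v]|.-1.
Proof.
move=> ZZ Z0; set S := [set P in _ | _].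
have eqR : {in [set v : V | v != 0] & &, equivalence_rel (@proportional F m.+1)}.
  by move=> u v w _ _ _; apply: proportional_equiv.
have part := equivalence_partitionP eqR.
have/and3P[/eqP cov triv n0] := part.
have blockE P v : P \in proj_space F m -> v \in P ->
    v != 0 /\ P = [set w | proportional v w].
  move=> PP vP.
  have v0 : v \in [set v : V | v != 0].
    by rewrite -cov; apply/bigcupP; exists P.
  split; first by rewrite inE in v0.
  rewrite -(def_pblock triv PP vP); apply/setP => w; rewrite inE.
  have [w0|w_eq0] := boolP (w \in [set v : V | v != 0]).
    by rewrite pblock_equivalence_partition.
  have -> : (w \in pblock (equivalence_partition (@proportional F m.+1)
               [set v | v != 0]) v) = false.
    apply: contraNF w_eq0 => wv; rewrite -cov; apply/bigcupP.
    by exists (pblock (proj_space F m) v); rewrite // pblock_mem // cov.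
  apply/esym; apply: contraNF w_eq0 => /existsP[c /andP[c0 /eqP ->]].
  by rewrite !inE in v0 *; rewrite scaler_eq0 negb_or c0.
have -> : #|[set v | Z v]|.-1 = #|[set v | Z v] :\ 0|.
  by rewrite (cardsD1 0 [set v | Z v]) inE Z0.
apply/esym/card_uniform_partition => [P|].
  rewrite inE => /andP[PP _].
  have /set0Pn[v vP] : P != set0 by apply: contraNneq n0 => <-.
  by have [v0 ->] := blockE P v PP vP; apply: card_line.
apply/and3P; split.
- apply/eqP/setP => v; rewrite !inE; apply/bigcupP/andP => [[P]|[v0 Zv]].
    rewrite inE => /andP[PP /forall_inP ZP] vP.
    by have [v0 _] := blockE P v PP vP; rewrite ZP.
  have vD : v \in cover (proj_space F m) by rewrite cov inE.
  have vB : v \in pblock (proj_space F m) v by rewrite mem_pblock.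
  exists (pblock (proj_space F m) v) => //.
  rewrite inE pblock_mem //; apply/forall_inP => w.
  have [_ ->] := blockE _ _ (pblock_mem vD) vB.
  by rewrite inE => /existsP[c /andP[c0 /eqP ->]]; apply: ZZ.
- by apply: trivIsetS triv; apply/subsetP => P; rewrite inE => /andP[].
- by rewrite inE negb_and n0.
Qed.

(** The cone over the whole projective space is the whole vector space. *)
Lemma card_proj_space :
  (#|proj_space F m| * #|F|.-1)%N = (#|F| ^ m.+1).-1.
Proof.
have <- : #|[set v : V | predT v]| = (#|F| ^ m.+1)%N.
  by rewrite -[m.+1 in RHS]mul1n -card_mx -cardsT.
rewrite -card_cone //; congr (_ * _)%N; apply: eq_card => P.
rewrite inE; apply/esym/andb_idr => _.
exact/forall_inP.
Qed.

End Cones.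

Theorem proposition5p9 (F : finFieldType) (q d n : nat)
    (hq : #|F| = q) (hq6 : (q = 5 %[mod 6])%N)
    (hd : (1 <= d)%N) (hgcd : gcdn (2 * d + 1) (q - 1) = 1%N) (hn : (2 <= n)%N) :
  #|Ypoints F d n| = #|proj_space F (2 * n - 2)| /\
  (#|proj_space F (2 * n - 2)|%:R : rat) =
    (q%:R ^+ (2 * n - 1) - 1) / (q%:R - 1).
Proof.
have q_gt1 : (1 < q)%N by rewrite -hq finNzRing_gt1.
have n_gt0 : (0 < n)%N by apply: ltnW.
have cardP : (#|proj_space F (2 * n - 2)| * q.-1)%N = (q ^ (2 * n - 1)).-1.
  rewrite -{1}hq card_proj_space hq; congr (_ ^ _).-1; lia.
split.
  apply/eqP; rewrite -(@eqn_pmul2r q.-1); last by rewrite -subn1 subn_gt0.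
  rewrite cardP -hq; apply/eqP.
  rewrite -(@card_twisted_zeros F d n) ?hq //; last first.
    by rewrite /coprime -subn1 hgcd.
  rewrite -hq -card_cone; first last.
  - by rewrite twist0 mul0mx.
  - by move=> c v _ /eqP v0; rewrite twistZ -scalemxAl v0 scaler0.
  congr (_ * _)%N; apply: eq_card => P; rewrite !inE; congr (_ && _).
  by apply: eq_forallb => v; rewrite - forms_vanishE.
have q1 : q%:R - 1 != 0 :> rat.
  by rewrite -(natrB _ (ltnW q_gt1)) Num.Theory.pnatr_eq0 subn_eq0 -ltnNge.
apply: (mulIf q1); rewrite divfK //.
have qX_gt0 : (0 < q ^ (2 * n - 1))%N by rewrite expn_gt0 ltnW.
rewrite -natrX -(natrB _ (ltnW q_gt1)) -(natrB _ qX_gt0).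
by rewrite -natrM !subn1 cardP subn1.
Qed.
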